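(* The Henneberg surface $H_1$ is the only surface of complexity $m=1$ that solves the period problem and descends to a 1-sided quotient. That is, if $(c,a_1,a_2)\in\mathbb{S}^1\times(\mathbb{C}\setminus\{0\})^2$ is a solution of the period problem with complexity $m=1$, then the branched minimal surface it defines is congruent in $\mathbb{R}^3$ to the Henneberg surface $H_1$.
   Context: For $m\in\mathbb{N}$ and $(c,a_1,\dots,a_{m+1})\in\mathbb{S}^1\times(\mathbb{C}\setminus\{0\})^{m+1}$ (where $\mathbb{S}^1=\{|c|=1\}$), put $$P(z)=\prod_{j=1}^{m+1}(z-a_j)\Big(z+\frac1{\overline{a_j}}\Big)=\sum_{h=0}^{2m+2}A_hz^h,\qquad f(z)=\frac{c}{z^{m+3}}P(z).$$ The list $(c,a_1,\dots,a_{m+1})$ is a solution of the period problem with complexity $m$ if $$-\frac{\overline c}{c}=\prod_{j=1}^{m+1}\frac{a_j}{\overline{a_j}},\qquad \overline{cA_m}=-cA_{m+2},\qquad \mathrm{Im}(cA_{m+1})=0 .$$ In that case, with $g(z)=z$ and $\omega=f\,dz$, the map $X=\mathrm{Re}\int\left(\frac12(1-g^2)\omega,\frac i2(1+g^2)\omega,g\omega\right)$ is a well-defined branched minimal immersion $\mathbb{C}\setminus\{0\}\to\mathbb{R}^3$ (up to translation) that descends to the quotient by $z\mapsto-1/\overline z$. This is the branched minimal surface defined by the list. The Henneberg surface $H_1$ is the surface defined in this way by $g(z)=z$, $\omega=z^{-4}(z^4-1)\,dz$, i.e. by the list $(1,1,i)$. Congruent means equal up to an isometry of $\mathbb{R}^3$.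 *)

(* Defs.v *)
From mathcomp Require Import all_boot all_order all_algebra.
From mathcomp Require Import all_classical all_reals all_analysis.
From mathcomp Require Import complex.

Set Implicit Arguments.
Unset Strict Implicit.
Unset Printing Implicit Defensive.

Import Order.TTheory GRing.Theory Num.Theory.
Import numFieldNormedType.Exports.

Local Open Scope classical_set_scope.
Local Open Scope ring_scope.

(* [derivable] does not find the normed module structure on the bare type
   [R[i]]; at [complexField R] it does, and there [derivable psi z 1] is complex
   differentiability of [psi] at [z]. *)
Definition complexField (R : realType) : numClosedFieldType := R[i]%C.

Section Defs.
Variable R : realType.
Local Notation C := (R[i]%C).

(* The polynomial P of the list; A_h is its coefficient P`_h. *)
Definition list_poly (m : nat) (a : m.+1.-tuple C) : {poly C} :=
  \prod_(b <- a) (('X - b%:P) * ('X + ((conjc b)^-1)%:P)).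

Definition list_fun (m : nat) (c : C) (a : m.+1.-tuple C) (z : C) : C :=
  c / z ^+ (m + 3) * (list_poly a).[z].

Definition solves_period_problem (m : nat) (c : C) (a : m.+1.-tuple C) : Prop :=
  let P := list_poly a in
  [/\ `|c| = 1 /\ (forall b, b \in tval a -> b != 0),
      - (conjc c / c) = \prod_(b <- a) (b / conjc b),
      conjc (c * P`_m) = - (c * P`_m.+2)
    & complex.Im (c * P`_m.+1) = 0].

(* The Weierstrass form Phi, with omega = f dz. *)
Definition weierstrass_form (g f : C -> C) (z : C) : 'rV[C]_3 :=
  \row_(k < 3) [:: 2^-1 * (1 - g z ^+ 2) * f z;
                   ('i%C / 2) * (1 + g z ^+ 2) * f z;
                   g z * f z]`_k.

Definition C1_fun (x : R -> R) : Prop :=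
  (forall t, derivable x t 1) /\ continuous (derive1 x).

(* The real part of the line integral of phi dz along the path x + iy,
   parametrized by [0, 1]. *)
Definition Re_path_integral (phi : C -> C) (x y : R -> R) : R :=
  \int[lebesgue_measure]_(t in `[0, 1])
    complex.Re (phi (x t +i* y t)%C * (derive1 x t +i* derive1 y t)%C).

(* X = Re \int Phi on C \ {0}: the integral of Re Phi along every C^1 path
   avoiding 0 is the difference of the values of X at the end points.  Thus X is
   determined up to a translation, and its existence says that the integral is
   path independent.  The value of X at 0 is irrelevant. *)
Definition weierstrass_map (g f : C -> C) (X : C -> 'rV[R]_3) : Prop :=
  forall x y : R -> R, C1_fun x -> C1_fun y ->
    (forall t, 0 <= t <= 1 -> (x t +i* y t)%C != 0) ->
  forall k : 'I_3,
    X (x 1 +i* y 1)%C ord0 k - X (x 0 +i* y 0)%C ord0 k =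
    Re_path_integral (fun z => weierstrass_form g f z ord0 k) x y.

Definition antipode (z : C) : C := - (conjc z)^-1.

(* Maps on the quotient of C \ {0} by the antipode are represented by
   antipode-invariant maps on C \ {0}. *)
Definition descends (X : C -> 'rV[R]_3) : Prop :=
  forall z, z != 0 -> X (antipode z) = X z.

Definition list_surface (m : nat) (c : C) (a : m.+1.-tuple C)
    (X : C -> 'rV[R]_3) : Prop :=
  weierstrass_map id (list_fun c a) X /\ descends X.

Definition henneberg_surface (X : C -> 'rV[R]_3) : Prop :=
  weierstrass_map id (fun z => z ^- 4 * (z ^+ 4 - 1)) X /\ descends X.

Lemma henneberg_list_fun (z : C) :
  list_fun 1 [tuple 1; 'i%C] z = z ^- 4 * (z ^+ 4 - 1).
Proof.
have ci : conjc ('i%C : C) = - 'i%C.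
  by apply/eqP; rewrite eq_complex /= oppr0 !eqxx.
have vi : (- 'i%C : C)^-1 = 'i%C.
  have h : (- 'i%C : C) * 'i%C = 1 by rewrite mulNr -expr2 sqr_i opprK.
  have u : (- 'i%C : C) != 0.
    by apply: contra_eq_neq h => ->; rewrite mul0r eq_sym oner_neq0.
  by apply: (mulfI u); rewrite h mulfV.
rewrite /list_fun /list_poly big_cons big_seq1 ci vi conjc1 invr1 !hornerE /=.
rewrite -!mulrA; congr (_ * _).
rewrite mulrA -!subr_sqr sqr_i expr1n opprK -subr_sqr expr1n.
by rewrite -exprM.
Qed.

(* The norm of 'rV[R]_3 in the library is the sup norm, hence this definition. *)
Definition euclidean_dist (u v : 'rV[R]_3) : R :=
  Num.sqrt (\sum_(k < 3) (u ord0 k - v ord0 k) ^+ 2).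

Definition isometry (T : 'rV[R]_3 -> 'rV[R]_3) : Prop :=
  forall u v, euclidean_dist (T u) (T v) = euclidean_dist u v.

(* Y, followed by an isometry of R^3, equals X up to a change of parameter psi
   of the quotient of C \ {0} by the antipode, written as an
   antipode-equivariant bijection of C \ {0}.  The surfaces being conformally
   parametrized, psi is conformal on the quotient; of its two lifts to C \ {0},
   which differ by the antipode, one is holomorphic.  In particular X and
   T \o Y have the same image. *)
Definition congruent (X Y : C -> 'rV[R]_3) : Prop :=
  exists (T : 'rV[R]_3 -> 'rV[R]_3) (psi : C -> C),
    [/\ isometry T,
        set_bij [set z : C | z != 0] [set z : C | z != 0] psi,
        forall z : C, z != 0 ->
          derivable (psi : complexField R -> complexField R) z 1,
        forall z : C, z != 0 -> psi (antipode z) = antipode (psi z)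
      & forall z : C, z != 0 -> X (psi z) = T (Y z)].

End Defs.

(* Main.v *)
(* The antipodal symmetry of P and the period conditions force A_1 = A_2 = A_3 = 0
   and c A_0 = - conj c, so that f = c - conj c * z^-4.  If u^2 = conj c, the change
   of parameter z -> u z turns these data into those of the Henneberg surface (c = 1),
   turned about the third axis by the angle arg u.  The form Phi is a Laurent
   polynomial without residue, so its primitive is explicit and X is determined by f
   up to a translation. *)
Require Import Defs.
From mathcomp Require Import all_boot all_order all_algebra.
From mathcomp Require Import all_classical all_reals all_analysis.
From mathcomp Require Import complex.
From mathcomp Require Import ring lra.

Import Order.TTheory GRing.Theory Num.Theory.
Import numFieldNormedType.Exports.
Local Open Scope ring_scope.

Section HennebergSurface.
Variable R : realType.
Local Notation C := (R[i]%C).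
Local Notation Re := complex.Re.
Local Notation Im := complex.Im.

(** * The period problem of complexity 1 *)

(** In use [p] and [q] are the inverses of [conjc a] and [conjc b]; as free letters they leave a
    plain ring identity. *)
Lemma quartic_coefs (a b p q : C) :
  let P := (('X - a%:P) * ('X + p%:P)) * (('X - b%:P) * ('X + q%:P)) : {poly C} in
  [/\ P`_1 = (p - a) * - (b * q) - (a * p) * (q - b),
      P`_2 = - (a * p) - (b * q) + (p - a) * (q - b)
    & P`_3 = (p - a) + (q - b)].
Proof.
move=> P.
have -> : P = 'X^4 + ((p - a) + (q - b)) *: 'X^3
    + (- (a * p) - (b * q) + (p - a) * (q - b)) *: 'X^2
    + ((p - a) * - (b * q) - (a * p) * (q - b)) *: 'X + (a * p * b * q)%:P.
  by rewrite /P -!mul_polyC !(polyCD, polyCM, polyCN, polyCB); ring.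
by split; rewrite !(coefD, coefZ, coefXn, coefX, coefC) /= !(mulr0, mulr1, addr0, add0r).
Qed.

Lemma list_poly2 (a1 a2 : C) :
  list_poly [tuple a1; a2] =
  (('X - a1%:P) * ('X + (conjc a1)^-1%:P))
  * (('X - a2%:P) * ('X + (conjc a2)^-1%:P)).
Proof. by rewrite /list_poly big_cons big_seq1. Qed.

Lemma unit_mul_conjc (c : C) : `|c| = 1 -> c * conjc c = 1.
Proof. by move=> c1; rewrite -sqr_normc c1 expr1n. Qed.

(** For a = 1 and a = i the inverse of [conjc a] is a itself, so P = (X^2 - 1)(X^2 + 1) and its
    middle coefficients vanish. *)
Lemma henneberg_solves_period_problem :
  @solves_period_problem R 1 1 [tuple 1; 'i%C].
Proof.
have ci : conjc ('i%C : C) = - 'i%C by apply/eqP; rewrite eq_complex /= oppr0 !eqxx.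
have i2 : ('i%C : C) * 'i%C = -1 by rewrite -expr2 sqr_i.
have i0 : ('i%C : C) != 0 by rewrite eq_complex /= oner_eq0 andbF.
have vi : (- 'i%C : C)^-1 = 'i%C.
  by apply: (@mulfI _ (- 'i%C)); rewrite ?oppr_eq0// mulfV ?oppr_eq0// mulNr i2 opprK.
rewrite /solves_period_problem list_poly2 ci vi conjc1 invr1.
have [-> -> ->] := quartic_coefs 1 'i%C 1 'i%C.
split.
- split; first exact: normr1.
  by move=> b; rewrite !inE => /orP[]/eqP->; rewrite ?oner_eq0.
- by rewrite big_cons big_seq1 ci conjc1 !divr1 mul1r vi i2 mulr1.
- by rewrite !subrr !mul0r !mulr0 subr0 mulr0 conjc0 addr0 mulr0 oppr0.
- by rewrite !mul1r !subrr mulr0 addr0 i2 opprK addrC subrr.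
Qed.

(* The antipodal symmetry of P gives conj (c A_1) = c A_3 and
   conj (c A_2) = - c A_2, so that with the period conditions A_1, A_2 and A_3
   vanish. *)
Lemma solution_list_fun (c a1 a2 z : C) :
  @solves_period_problem R 1 c [tuple a1; a2] -> z != 0 ->
  list_fun c [tuple a1; a2] z = c - conjc c * z^-1 ^+ 4.
Proof.
move=> [[c1 a0]]; rewrite big_cons big_seq1 list_poly2.
have [-> -> ->] := quartic_coefs a1 a2 (conjc a1)^-1 (conjc a2)^-1.
have {a0}[n1 n2] : a1 != 0 /\ a2 != 0 by split; apply: a0; rewrite !inE eqxx ?orbT.
have c0 : c != 0 by rewrite -normr_gt0 c1.
move=> ePi e1 /eqP e2 z0; rewrite /list_fun list_poly2 !hornerE.
(* Being real is restated as being fixed by conjugation, an algebraic identity like [e1]. *)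
have {}e2 : conjc (c * (- (a1 * (conjc a1)^-1) - (a2 * (conjc a2)^-1)
    + ((conjc a1)^-1 - a1) * ((conjc a2)^-1 - a2)))
   = c * (- (a1 * (conjc a1)^-1) - (a2 * (conjc a2)^-1)
    + ((conjc a1)^-1 - a1) * ((conjc a2)^-1 - a2)).
  move: e2; case: (c * _) => u v /= /eqP ->.
  by rewrite oppr0.
have cV (x : C) : conjc x^-1 = (conjc x)^-1 := conjc_inv x.
have cK (x : C) : conjc (conjc x) = x := conjcK x.
(* The conjugate of A_3 = 0 is recorded now, before the conjugates become independent letters. *)
have : (conjc a1)^-1 - a1 + ((conjc a2)^-1 - a2) = 0 ->
    a1^-1 - conjc a1 + (a2^-1 - conjc a2) = 0.
  move/(congr1 conjc) => e; apply: etrans (etrans e (conjc0 _)).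
  by rewrite !(rmorphD, rmorphN) /= !cV !cK.
move: e1 e2; rewrite !(rmorphM, rmorphD, rmorphB, rmorphN) /= !cV !cK.
have := conjc_eq0 a1; have := conjc_eq0 a2; have := conjc_eq0 c.
rewrite (negbTE n1) (negbTE n2) (negbTE c0).
move: ePi; move: (conjc a1) (conjc a2) (conjc c) => b1 b2 d ePi /negbT d0 /negbT m2 /negbT m1.
(* The first period condition eliminates [conjc c]. *)
have {ePi}-> : d = - c * (a1 / b1 * (a2 / b2)) by rewrite -ePi; field.
move=> e1 e2 s3J.
have two0 : (2 : C) != 0 by rewrite pnatr_eq0.
(* After this elimination the left side of [e1] is c A_3, its right side - c A_3. Likewise [e2]
   equates - c A_2 with c A_2. *)
have s3 : b1^-1 - a1 + (b2^-1 - a2) = 0.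
  have : 2 * c * (b1^-1 - a1 + (b2^-1 - a2)) = 0.
    rewrite -[RHS](subrr (c * (b1^-1 - a1 + (b2^-1 - a2)))) -[X in _ = _ - X]opprK -e1.
    by field; rewrite ?n1 ?n2 ?m1 ?m2.
  by move/eqP; rewrite !mulf_eq0 (negbTE two0) (negbTE c0) /= => /eqP.
have s2 : - (a1 / b1) - a2 / b2 + (b1^-1 - a1) * (b2^-1 - a2) = 0.
  have : 2 * c * (- (a1 / b1) - a2 / b2 + (b1^-1 - a1) * (b2^-1 - a2)) = 0.
    rewrite -[RHS](subrr (c * (- (a1 / b1) - a2 / b2 + (b1^-1 - a1) * (b2^-1 - a2)))).
    rewrite -[X in _ = _ - X]e2.
    by field; rewrite ?n1 ?n2 ?m1 ?m2.
  by move/eqP; rewrite !mulf_eq0 (negbTE two0) (negbTE c0) /= => /eqP.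
(* A_1 is - A_0 times the conjugate of A_3. *)
have s1 : (b1^-1 - a1) * - (a2 / b2) - a1 / b1 * (b2^-1 - a2) = 0.
  transitivity (- (a1 / b1 * (a2 / b2)) * (a1^-1 - b1 + (a2^-1 - b2))).
    by field; rewrite n1 n2 m1 m2.
  by rewrite s3J ?mulr0.
transitivity (c / z ^+ 4 * (z ^+ 4 + (b1^-1 - a1 + (b2^-1 - a2)) * z ^+ 3
  + (- (a1 / b1) - a2 / b2 + (b1^-1 - a1) * (b2^-1 - a2)) * z ^+ 2
  + ((b1^-1 - a1) * - (a2 / b2) - a1 / b1 * (b2^-1 - a2)) * z
  + (a1 / b1 * (a2 / b2)))).
  by field; rewrite z0 m1 m2.
rewrite s1 s2 s3 !mul0r !addr0.
by field; rewrite z0 m1 m2.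
Qed.

(** * Derivatives along curves *)

(** Stated on real and imaginary parts, so that the real fundamental theorem of calculus applies
    directly. *)
Definition cderive (w : R -> C) (t : R) (d : C) : Prop :=
  is_derive t 1 (fun s => Re (w s)) (Re d) /\
  is_derive t 1 (fun s => Im (w s)) (Im d).

Lemma cderive_cst (a : C) t : cderive (fun=> a) t 0.
Proof. by split; exact: is_derive_cst. Qed.

Lemma cderiveD v w t d e :
  cderive v t d -> cderive w t e -> cderive (fun s => v s + w s) t (d + e).
Proof.
move=> [vr vi] [wr wi]; split.
- have -> : (fun s => Re (v s + w s)) = (fun s => Re (v s)) + (fun s => Re (w s)).
    by apply/funext => s; rewrite fctE; case: (v s) (w s) => [? ?] [? ?].
  by apply: is_derive_eq; case: (d) (e) => [? ?] [? ?].
- have -> : (fun s => Im (v s + w s)) = (fun s => Im (v s)) + (fun s => Im (w s)).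
    by apply/funext => s; rewrite fctE; case: (v s) (w s) => [? ?] [? ?].
  by apply: is_derive_eq; case: (d) (e) => [? ?] [? ?].
Qed.

Lemma cderiveM v w t d e :
  cderive v t d -> cderive w t e ->
  cderive (fun s => v s * w s) t (d * w t + v t * e).
Proof.
move=> [vr vi] [wr wi]; split.
- have -> : (fun s => Re (v s * w s)) =
     (fun s => Re (v s)) * (fun s => Re (w s)) - (fun s => Im (v s)) * (fun s => Im (w s)).
    by apply/funext => s; rewrite !fctE; case: (v s) (w s) => [? ?] [? ?].
  apply: is_derive_eq; rewrite /GRing.scale /=.
  case: (v t) (w t) (d) (e) => [? ?] [? ?] [? ?] [? ?] /=.
  ring.
- have -> : (fun s => Im (v s * w s)) =
     (fun s => Re (v s)) * (fun s => Im (w s)) + (fun s => Im (v s)) * (fun s => Re (w s)).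
    by apply/funext => s; rewrite !fctE; case: (v s) (w s) => [? ?] [? ?].
  apply: is_derive_eq; rewrite /GRing.scale /=.
  case: (v t) (w t) (d) (e) => [? ?] [? ?] [? ?] [? ?] /=.
  ring.
Qed.

Lemma cderiveV w t d : w t != 0 -> cderive w t d ->
  cderive (fun s => (w s)^-1) t (- (w t)^-1 ^+ 2 * d).
Proof.
move=> w0 [wr wi].
(* The inverse of w is conj w divided by this squared modulus. *)
pose n s := Re (w s) ^+ 2 + Im (w s) ^+ 2.
have n0 : n t != 0.
  by move: w0; rewrite /n; case: (w t) => a b; rewrite eq_complex /= paddr_eq0 ?sqr_ge0// !sqrf_eq0.
have dn : is_derive t 1 n (2 * (Re (w t) * Re d + Im (w t) * Im d)).
  have -> : n = (fun s => Re (w s)) ^+ 2 + (fun s => Im (w s)) ^+ 2.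
    by apply/funext => s; rewrite /n !fctE.
  apply: is_derive_eq; rewrite /GRing.scale /= !expr1.
  ring.
have dV : is_derive t 1 (fun s => (n s)^-1)
    (- (n t) ^- 2 * (2 * (Re (w t) * Re d + Im (w t) * Im d))).
  apply: DeriveDef; first exact: derivableV.
  by rewrite deriveV// derive_val.
split.
- have -> : (fun s => Re (w s)^-1) = (fun s => Re (w s)) * (fun s => (n s)^-1).
    by apply/funext => s; rewrite /n !fctE; case: (w s).
  apply: is_derive_eq; rewrite /GRing.scale /=.
  move: n0; rewrite /n.
  case: (w t) (d) => [a b] [u v] n0 /=.
  by field; exact: n0.
- have -> : (fun s => Im (w s)^-1) = - ((fun s => Im (w s)) * (fun s => (n s)^-1)).
    by apply/funext => s; rewrite /n !fctE; case: (w s).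
  apply: is_derive_eq; rewrite /GRing.scale /=.
  move: n0; rewrite /n.
  case: (w t) (d) => [a b] [u v] n0 /=.
  by field; exact: n0.
Qed.

Lemma cderive_continuous w t d : cderive w t d ->
  {for t, continuous (fun s => Re (w s))} /\ {for t, continuous (fun s => Im (w s))}.
Proof.
by move=> [[wr _] [wi _]]; split; apply: differentiable_continuous; exact/derivable1_diffP.
Qed.

(* Complex differentiability, tested on real curves through z: what the
   fundamental theorem of calculus along a path needs. *)
Definition curve_derive (F : C -> C) (z l : C) : Prop :=
  forall w t d, w t = z -> cderive w t d -> cderive (F \o w) t (l * d).

Lemma curve_derive_eq F z l l' : curve_derive F z l -> l = l' -> curve_derive F z l'.
Proof. by move=> h <-. Qed.

Lemma curve_derive_id z : curve_derive id z 1.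
Proof. by move=> w t d _ h; rewrite mul1r. Qed.

Lemma curve_derive_cst a z : curve_derive (fun=> a) z 0.
Proof. by move=> w t d _ h; rewrite mul0r; exact: cderive_cst. Qed.

Lemma curve_deriveD F G z l m : curve_derive F z l -> curve_derive G z m ->
  curve_derive (fun z => F z + G z) z (l + m).
Proof. by move=> h k w t d e f; rewrite mulrDl; apply: cderiveD; [exact: h|exact: k]. Qed.

Lemma curve_deriveM F G z l m : curve_derive F z l -> curve_derive G z m ->
  curve_derive (fun z => F z * G z) z (l * G z + F z * m).
Proof.
move=> h k w t d e f.
have := cderiveM _ _ _ _ _ (h _ _ _ e f) (k _ _ _ e f).
by rewrite /= e mulrDl !mulrA [l * d * _]mulrAC.
Qed.

Lemma curve_deriveN F z l : curve_derive F z l ->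
  curve_derive (fun z => - F z) z (- l).
Proof.
move=> h w t d e f; rewrite mulNr.
have := cderiveM _ _ _ _ _ (cderive_cst (-1) t) (h _ _ _ e f).
rewrite mul0r add0r mulN1r.
by congr cderive; apply/funext => s /=; rewrite mulN1r.
Qed.

Lemma curve_deriveX n F z l : curve_derive F z l ->
  curve_derive (fun z => F z ^+ n) z (n%:R * F z ^+ n.-1 * l).
Proof.
move=> h; elim: n => [|n IH].
  by under eq_fun do rewrite expr0; rewrite !mul0r; exact: curve_derive_cst.
under eq_fun do rewrite exprS.
apply: curve_derive_eq (curve_deriveM _ _ _ _ _ h IH) _ => /=.
(* The predecessor [n.-1] is truncated at 0, hence the case split. *)
case: n {IH} => [|n] /=; first by rewrite expr0 mul0r mul0r mulr0 addr0 mulr1 !mul1r.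
by rewrite -[n.+2%:R]natr1 exprS; ring.
Qed.

Lemma curve_deriveV z : z != 0 -> curve_derive (fun z => z^-1) z (- z^-1 ^+ 2).
Proof.
move=> z0 w t d e h.
by have := cderiveV _ _ _ _ h; rewrite e; apply.
Qed.

(** The fundamental theorem of calculus for Re F along the path; the derivatives of [phi] supply the
    continuity of the integrand. *)
Lemma Re_path_integralE (F phi : C -> C) (x y : R -> R) :
  (forall z : C, z != 0 -> curve_derive F z (phi z)) ->
  (forall z : C, z != 0 -> exists l, curve_derive phi z l) ->
  C1_fun x -> C1_fun y ->
  (forall t, 0 <= t <= 1 -> (x t +i* y t)%C != 0) ->
  Re_path_integral phi x y = Re (F (x 1 +i* y 1)%C) - Re (F (x 0 +i* y 0)%C).
Proof.
move=> dF dphi [dx cx] [dy cy] w0.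
pose w t := (x t +i* y t)%C.
pose dw t := (derive1 x t +i* derive1 y t)%C.
have dwP t : cderive w t (dw t).
  by split=> /=; rewrite derive1E; exact: derivableP.
have dFw (t : R) : 0 <= t <= 1 -> is_derive t 1 (fun s => Re (F (w s))) (Re (phi (w t) * dw t)).
  by move=> /w0 wt; have [+ _] := dF _ wt w t _ erefl (dwP t).
have cFw (t : R) : 0 <= t <= 1 -> {for t, continuous (fun s => Re (F (w s)))}.
  by move=> /dFw [h _]; apply: differentiable_continuous; exact/derivable1_diffP.
rewrite /Re_path_integral /Rintegral (@continuous_FTC2 _ _ (fun s => Re (F (w s)))) //.
- apply: continuous_in_subspaceT => t; rewrite inE /= in_itv /= => /w0 wt.
  have [l /(_ w t _ erefl (dwP t))/cderive_continuous[cr ci]] := dphi _ wt.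
  have -> : (fun s => Re (phi (w s) * dw s)) =
     (fun s => Re (phi (w s)) * derive1 x s - Im (phi (w s)) * derive1 y s).
    by apply/funext => s; rewrite /dw; case: (phi (w s)).
  by apply: cvgB; apply: cvgM => //; [exact: cx|exact: cy].
- split.
  + by move=> t; rewrite in_itv /= => /andP[/ltW t0 /ltW t1]; have [] := dFw t; rewrite ?t0.
  + by apply: cvg_at_right_filter; apply: cFw; rewrite lexx ler01.
  + by apply: cvg_at_left_filter; apply: cFw; rewrite lexx ler01.
- move=> t; rewrite in_itv /= => /andP[/ltW t0 /ltW t1].
  by have [] := dFw t; rewrite ?t0// derive1E => _ ->.
Qed.

(** * Weierstrass maps *)

Lemma C1_fun_affine (a b : R) : C1_fun (fun t => a + t * b).
Proof.
have d (t : R) : is_derive t 1 (fun t : R => a + t * b) b.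
  have -> : (fun t : R => a + t * b) = cst a + b \*: id.
    by apply/funext => s; rewrite !fctE mulrC.
  by apply: is_derive_eq; rewrite add0r /GRing.scale /= mulr1.
split=> [t|]; first by have [] := d t.
have -> : derive1 (fun t : R => a + t * b) = cst b.
  by apply/funext => t; rewrite derive1E; have [_ ->] := d t.
exact: cst_continuous.
Qed.

(** Along the segment both increments are the same integral. *)
Lemma weierstrass_map_segment (g f : C -> C) (X Y : C -> 'rV[R]_3) (a b u v : R) :
  weierstrass_map g f X -> weierstrass_map g f Y ->
  (forall t : R, 0 <= t <= 1 -> ((a + t * (u - a)) +i* (b + t * (v - b)))%C != 0) ->
  X (u +i* v)%C - Y (u +i* v)%C = X (a +i* b)%C - Y (a +i* b)%C.
Proof.
move=> hX hY w0; apply/rowP => k; rewrite !mxE.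
have := hX _ _ (C1_fun_affine a (u - a)) (C1_fun_affine b (v - b)) w0 k.
have := hY _ _ (C1_fun_affine a (u - a)) (C1_fun_affine b (v - b)) w0 k.
rewrite !mul0r !mul1r !addr0 ![_ + (_ - _)]addrC !subrK => <- e.
by rewrite -[X (u +i* v)%C 0 k](subrK (X (a +i* b)%C 0 k)) e; ring.
Qed.

Lemma weierstrass_map_unique (g f : C -> C) (X Y : C -> 'rV[R]_3) :
  weierstrass_map g f X -> weierstrass_map g f Y ->
  forall z, z != 0 -> X z - Y z = X 1 - Y 1.
Proof.
move=> hX hY [u v] z0.
(* The negative real axis is reached from 1 through i, every other point by a
   segment. *)
have [uv|] := boolP ((v != 0) || (0 < u)).
  apply: (weierstrass_map_segment _ _ _ _ 1 0 u v hX hY) => t /andP[t0 t1].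
  rewrite eq_complex /= add0r subr0 mulf_eq0.
  apply/negP => /andP[/eqP e /orP[/eqP te|/eqP ve]].
    by move: e; rewrite te mul0r addr0 => /eqP; rewrite oner_eq0.
  move: uv; rewrite ve eqxx /= => u0; nra.
rewrite negb_or negbK -leNgt => /andP[/eqP v0 u_le0]; subst v.
have {}z0 : u < 0.
  by rewrite lt_neqAle u_le0 andbT; move: z0; rewrite eq_complex /= eqxx andbT.
transitivity (X (0 +i* 1)%C - Y (0 +i* 1)%C).
  apply: (weierstrass_map_segment _ _ _ _ 0 1 u 0 hX hY) => t _.
  rewrite eq_complex /= add0r subr0 mulf_eq0 (lt_eqF z0) orbF.
  apply/negP => /andP[/eqP -> /eqP]; rewrite mul0r addr0 => /eqP.
  by rewrite oner_eq0.
apply: (weierstrass_map_segment _ _ _ _ 1 0 0 1 hX hY) => t _.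
(* On the segment from 1 to i the coordinates sum to 1. *)
rewrite eq_complex /=; apply/negP => /andP[/eqP e /eqP te]; lra.
Qed.

(** * The explicit primitive and its antipodal symmetry *)

(* For phi = c - conj c * z^-4, p and q are the primitives of phi and of
   - z^2 phi, that is, of Phi_1 - i Phi_2 and of Phi_1 + i Phi_2. *)
Definition rotated_henneberg_primitive (c z : C) : 'rV[C]_3 :=
  let p := c * z + conjc c * (z^-1 ^+ 3 / 3) in
  let q := - (c * (z ^+ 3 / 3)) - conjc c * z^-1 in
  \row_(k < 3) [:: (p + q) / 2; 'i%C * ((p - q) / 2);
                   c * (z ^+ 2 / 2) + conjc c * (z^-1 ^+ 2 / 2)]`_k.

Definition rotated_henneberg (c z : C) : 'rV[R]_3 :=
  \row_k Re (rotated_henneberg_primitive c z ord0 k).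

Ltac curve_deriv := repeat first
  [ exact: curve_derive_cst | exact: curve_derive_id
  | by apply: curve_deriveV
  | apply: curve_deriveN | apply: curve_deriveX
  | apply: curve_deriveM | apply: curve_deriveD
  | apply: (curve_deriveX _ _ (fun z => z^-1)) ].

Lemma weierstrass_rotated_henneberg (c : C) (f : C -> C) :
  (forall z, z != 0 -> f z = c - conjc c * z^-1 ^+ 4) ->
  weierstrass_map id f (rotated_henneberg c).
Proof.
move=> fE x y hx hy w0 k; rewrite !mxE.
pose phi z := weierstrass_form id (fun z => c - conjc c * z^-1 ^+ 4) z ord0 k.
(* [f] is known only off 0, where the path runs, so it is first replaced by its Laurent
   polynomial. *)
transitivity (Re_path_integral phi x y); last first.
  apply: eq_Rintegral => t; rewrite inE /= in_itv /= => /w0 /fE e.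
  by rewrite /phi /weierstrass_form !mxE e.
rewrite (Re_path_integralE (fun z => rotated_henneberg_primitive c z ord0 k)) //; rewrite /phi.
- by rewrite !mxE.
- move=> z z0.
  under eq_fun do rewrite mxE; rewrite /weierstrass_form mxE.
  case: k {phi} => -[|[|[|//]]] ? /=;
    by apply: curve_derive_eq; [by curve_deriv|rewrite /=; field].
- move=> z z0; case: k {phi} => -[|[|[|//]]] ?; eexists;
    under eq_fun do rewrite /weierstrass_form mxE /=; curve_deriv.
Qed.

(** The primitive takes conjugate values at antipodal points: p at the antipode of z is the
    conjugate of q at z, and the third coordinate is conjugated. *)
Lemma descends_rotated_henneberg (c : C) : descends (rotated_henneberg c).
Proof.
move=> z z0; apply/rowP => k; rewrite !mxE.
have ReJ (w : C) : Re (conjc w) = Re w by case: w.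
have JD (v w : C) : conjc (v + w) = conjc v + conjc w := rmorphD _ v w.
have JM (v w : C) : conjc (v * w) = conjc v * conjc w := rmorphM _ v w.
have JN (v : C) : conjc (- v) = - conjc v := rmorphN _ v.
have JX n (v : C) : conjc (v ^+ n) = conjc v ^+ n := rmorphXn _ n v.
have JV (v : C) : conjc v^-1 = (conjc v)^-1 := conjc_inv v.
have JK (v : C) : conjc (conjc v) = v := conjcK v.
have Jn n : conjc (n%:R : C) = n%:R := conjc_nat R n.
have Ji : conjc ('i%C : C) = - 'i%C by apply/eqP; rewrite eq_complex /= oppr0 !eqxx.
have := conjc_eq0 z; rewrite (negbTE z0) => /negbT zJ0.
rewrite -[RHS]ReJ; congr Re.
by case: k => -[|[|[|//]]] ? /=; rewrite /antipode !(JD, JM, JN, JX, JV, JK, Jn, Ji);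
  field.
Qed.

(** * Rotation about the third axis and the congruence *)

Definition vertical_rotation (u : C) : 'M[R]_3 :=
  \matrix_(i < 3, j < 3) [:: [:: Re u; Im u; 0]`_j; [:: - Im u; Re u; 0]`_j;
                             [:: 0; 0; 1]`_j]`_i.

(** Replacing z by u z multiplies p by [conjc u] and q by u and fixes the third coordinate. As X_1 +
    i X_2 = conj p + q (p and q halved), the horizontal part is multiplied by u, which is the action
    of [vertical_rotation u] on row vectors. *)
Lemma rotated_hennebergE (u c z : C) :
  u * conjc u = 1 -> c * u ^+ 2 = 1 -> z != 0 ->
  rotated_henneberg c (u * z) = rotated_henneberg 1 z *m vertical_rotation u.
Proof.
move=> uJ cu z0.
have u0 : u != 0 by apply: contra_eq_neq uJ => ->; rewrite mul0r eq_sym oner_neq0.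
have cE : c = u^-1 ^+ 2.
  by rewrite -[LHS]mulr1 -(divff (expf_neq0 2 u0)) mulrA cu mul1r exprVn.
have cJ : conjc c = u ^+ 2.
  rewrite cE (rmorphXn _ 2) /= conjc_inv.
  by rewrite -[_^-1]mul1r -uJ mulfK // conjc_eq0.
have uV : u^-1 = conjc u by apply: (mulfI u0); rewrite mulfV.
have J1 : conjc (1 : C) = 1 := conjc1 R.
pose p := (z + z^-1 ^+ 3 / 3) / 2; pose q := (- (z ^+ 3 / 3) - z^-1) / 2.
pose r := z ^+ 2 / 2 + z^-1 ^+ 2 / 2.
have EL : rotated_henneberg_primitive c (u * z) =
    \row_k [:: conjc u * p + u * q; 'i%C * (conjc u * p - u * q); r]`_k.
  apply/rowP => -[[|[|[|//]]] ?]; rewrite !mxE /= cJ cE -?uV /p /q /r; field;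
    by rewrite u0 z0.
have ER : rotated_henneberg_primitive 1 z = \row_k [:: p + q; 'i%C * (p - q); r]`_k.
  apply/rowP => -[[|[|[|//]]] ?]; rewrite !mxE J1 /= /p /q /r; field;
    by rewrite z0.
rewrite /rotated_henneberg EL ER.
apply/rowP => k; rewrite !mxE !big_ord_recl big_ord0 !mxE /=.
case: u p q r {uJ cu u0 cE cJ uV EL ER} => [a b] [p1 p2] [q1 q2] r.
case: k => -[|[|[|//]]] ? /=; ring.
Qed.

Lemma isometry_vertical_rotation (u : C) (v w : 'rV[R]_3) : u * conjc u = 1 ->
  Defs.isometry (fun x => (x - v) *m vertical_rotation u + w).
Proof.
move=> uJ x y; rewrite /euclidean_dist; congr Num.sqrt.
have {uJ} : Re u ^+ 2 + Im u ^+ 2 = 1.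
  by case: u uJ => a b /= [e _]; rewrite -e; ring.
rewrite !big_ord_recl !big_ord0 !mxE !big_ord_recl !big_ord0 !mxE /= => e.
move: (Re u) (Im u) e => a b e.
(* The squared horizontal distance is scaled by |u|^2 = 1. *)
transitivity ((a ^+ 2 + b ^+ 2) * ((x ord0 ord0 - y ord0 ord0) ^+ 2
    + (x ord0 (lift ord0 ord0) - y ord0 (lift ord0 ord0)) ^+ 2)
  + (x ord0 (lift ord0 (lift ord0 ord0)) - y ord0 (lift ord0 (lift ord0 ord0))) ^+ 2).
  by ring.
by rewrite e; ring.
Qed.

Lemma solution_congruent (c a1 a2 : C) (X H : C -> 'rV[R]_3) :
  @solves_period_problem R 1 c [tuple a1; a2] ->
  @list_surface R 1 c [tuple a1; a2] X -> henneberg_surface H -> congruent X H.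
Proof.
move=> sol [hX _] [hH _].
have c1 : `|c| = 1 by have [[]] := sol.
have u2 := sqr_sqrtc (conjc c); set u := sqrtc _ in u2.
have cu : c * u ^+ 2 = 1 by rewrite u2 unit_mul_conjc.
have uJ : u * conjc u = 1.
  apply: unit_mul_conjc; apply/eqP; rewrite -(@pexpr_eq1 _ _ 2) //.
  by rewrite -normrX u2 normcJ c1.
have u0 : u != 0 by apply: contra_eq_neq uJ => ->; rewrite mul0r eq_sym oner_neq0.
have XE : forall z : C, z != 0 ->
    X z - rotated_henneberg c z = X 1 - rotated_henneberg c 1.
  apply: weierstrass_map_unique hX _; apply: weierstrass_rotated_henneberg => z.
  exact: solution_list_fun.
have HE : forall z : C, z != 0 ->
    H z - rotated_henneberg 1 z = H 1 - rotated_henneberg 1 1.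
  apply: weierstrass_map_unique hH _; apply: weierstrass_rotated_henneberg => z z0.
  by rewrite conjc1; field.
(* Remove the translation of [H] from its model, rotate, then add the translation of [X]. *)
exists (fun x => (x - (H 1 - rotated_henneberg 1 1)) *m vertical_rotation u
   + (X 1 - rotated_henneberg c 1)), (fun z => u * z); split.
- exact: isometry_vertical_rotation.
- split.
  + by move=> z /= z0; rewrite mulf_neq0.
  + by move=> z w _ _ /(mulfI u0).
  + move=> z /= z0; exists (u^-1 * z); first by rewrite /= mulf_neq0 ?invr_eq0.
    by rewrite mulVKf.
- by move=> z z0; apply: derivableM.
- move=> z z0; rewrite /antipode rmorphM /= invfM.
  (* Multiplication by u commutes with the antipode because |u| = 1. *)
  have -> : (conjc u)^-1 = u.
    by apply: (@mulfI _ (conjc u)); rewrite ?conjc_eq0 // mulfV ?conjc_eq0 // mulrC.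
  by rewrite mulrN.
- move=> z z0.
  rewrite -(HE _ z0) opprB [H z + _]addrC subrK -(rotated_hennebergE u c) //.
  by rewrite -(XE (u * z)) ?mulf_neq0 // addrC subrK.
Qed.

End HennebergSurface.

Theorem theorem11 (R : realType) :
  @solves_period_problem R 1 1 [tuple 1; 'i%C] /\
  forall c a1 a2 : R[i]%C,
    @solves_period_problem R 1 c [tuple a1; a2] ->
    (exists X, @list_surface R 1 c [tuple a1; a2] X) /\
    (forall X H : R[i]%C -> 'rV[R]_3,
       @list_surface R 1 c [tuple a1; a2] X -> henneberg_surface H ->
       congruent X H).
Proof.
split=> [|c a1 a2 sol]; first exact: henneberg_solves_period_problem.
split=> [|X H hX hH]; last exact: solution_congruent sol hX hH.
(* The explicit model shows that the integral is well defined and descends. *)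
exists (rotated_henneberg R c); split; last exact: descends_rotated_henneberg.
apply: weierstrass_rotated_henneberg => z; exact: solution_list_fun.
Qed.
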